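(* There is no $4$-uniform Šoltés' hypergraph of order $9$.
   Context: A hypergraph $H=(V,E)$ consists of a finite vertex set $V$ and a set $E$ of distinct subsets of $V$ (hyperedges). $H$ is $k$-uniform if every hyperedge has exactly $k$ elements. The order of $H$ is $|V|$. For $u,w\in V$, the distance $d_H(u,w)$ is the least $\ell\ge 0$ such that there are vertices $u=x_0,\dots,x_\ell=w$ with $x_{i-1},x_i$ contained in a common hyperedge for each $i$ ($\infty$ if none exists); $H$ is connected if all distances are finite. $W(H)=\sum_{\{u,w\}\subseteq V,\,u\ne w} d_H(u,w)$. For $v\in V$, $H\setminus v$ has vertex set $V\setminus\{v\}$ and hyperedge set $\{e\in E: v\notin e\}$. A Šoltés' hypergraph is a connected hypergraph $H$ with $W(H\setminus v)=W(H)$ for every $v\in V$. *)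

(* Defs.v *)
From HB Require Import structures.
From mathcomp Require Import all_boot.

Set Implicit Arguments.
Unset Strict Implicit.
Unset Printing Implicit Defensive.

Record hypergraph (T : finType) := Hypergraph {
  hverts : {set T};
  hedges : {set {set T}};
  hedges_sub : [forall (e | e \in hedges), e \subset hverts] }.

(* Extended naturals: [None] is infinity. *)
Definition enat := option nat.

Definition eadd (x y : enat) : enat :=
  if x is Some m then if y is Some n then Some (m + n) else None else None.

Fact eaddA : associative eadd.
Proof. by case=> [m|] [n|] [p|] //=; rewrite addnA. Qed.

Fact eaddC : commutative eadd.
Proof. by case=> [m|] [n|] //=; rewrite addnC. Qed.

Fact eadd0 : left_id (Some 0) eadd.
Proof. by case. Qed.

HB.instance Definition _ := Monoid.isComLaw.Build enat (Some 0) eadd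
  eaddA eaddC eadd0.

Section Hypergraph.
Variables (T : finType) (H : hypergraph T).

Definition horder : nat := #|hverts H|.

Definition uniform (k : nat) : Prop := forall e, e \in hedges H -> #|e| = k.

Definition hadj : rel T :=
  [rel x y | [exists e in hedges H, (x \in e) && (y \in e)]].

Definition hwalk (u w : T) (l : nat) : bool :=
  [exists p : l.-tuple T, path hadj u p && (last u p == w)].

Fact hwalk_ex u w : connect hadj u w -> exists l, hwalk u w l.
Proof.
case/connectP=> p hp ->; exists (size p); apply/existsP.
by exists (in_tuple p); rewrite hp eqxx.
Qed.

Definition hdist (u w : T) : enat :=
  if @idP (connect hadj u w) is ReflectT c then Some (ex_minn (hwalk_ex c))
  else None.

Lemma hdist_Some u w l :
  hdist u w = Some l <-> hwalk u w l /\ (forall m, hwalk u w m -> l <= m).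
Proof.
rewrite /hdist; case: {-}_ / idP => [c|nc].
  case: ex_minnP => m hm minm; split=> [[<-] //|[hl minl]].
  by congr Some; apply/eqP; rewrite eqn_leq minm // minl.
split=> // -[/existsP[p /andP[hp /eqP hl]] _].
by case: nc; apply/connectP; exists (val p).
Qed.

Lemma hdist_None u w : hdist u w = None <-> (forall l, ~~ hwalk u w l).
Proof.
rewrite /hdist; case: {-}_ / idP => [c|nc].
  by split=> // hn; have [l hl] := hwalk_ex c; move: (hn l); rewrite hl.
split=> // _ l; apply/negP=> /existsP[p /andP[hp /eqP hl]].
by case: nc; apply/connectP; exists (val p).
Qed.

Definition hconnected : Prop :=
  forall u w, u \in hverts H -> w \in hverts H -> hdist u w <> None.

(* The comparison of ranks selects one ordered representative (u, w) of each
   unordered pair of distinct vertices; [hdist] is symmetric ([hdistC]). *)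
Definition wiener : enat :=
  \big[eadd/Some 0]_(p : T * T | [&& p.1 \in hverts H, p.2 \in hverts H
                                  & enum_rank p.1 < enum_rank p.2])
    hdist p.1 p.2.

Fact hdel_sub (v : T) :
  [forall (e | e \in [set e in hedges H | v \notin e]),
     e \subset hverts H :\ v].
Proof.
apply/forall_inP=> e; rewrite inE => /andP[eH ve].
by rewrite subsetD1 ve (forall_inP (hedges_sub H)).
Qed.

Definition hdel (v : T) : hypergraph T := Hypergraph (hdel_sub v).

End Hypergraph.

Lemma hwalkC (T : finType) (H : hypergraph T) u w l :
  hwalk H u w l = hwalk H w u l.
Proof.
suff imp x y : hwalk H x y l -> hwalk H y x l by apply/idP/idP; apply: imp.
case/existsP=> p /andP[hp /eqP <-]; apply/existsP.
have sz : size (rev (belast x p)) == l by rewrite size_rev size_belast size_tuple.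
exists (Tuple sz) => /=; rewrite rev_path; apply/andP; split.
  apply: sub_path hp => a b /existsP[e /and3P[eH ae be]].
  by apply/existsP; exists e; rewrite eH ae be.
by case: (val p) => [|a q] //=; rewrite rev_cons last_rcons.
Qed.

Lemma hdistC (T : finType) (H : hypergraph T) u w : hdist H u w = hdist H w u.
Proof.
case E: (hdist H w u) => [l|].
  have [hl ml] := (hdist_Some H w u l).1 E.
  apply/hdist_Some; split=> [|m]; rewrite hwalkC //; exact: ml.
by apply/hdist_None=> l; rewrite hwalkC; apply/(hdist_None H w u).1.
Qed.

Definition soltes (T : finType) (H : hypergraph T) : Prop :=
  hconnected H /\ forall v, v \in hverts H -> wiener (hdel H v) = wiener H.

(* Main.v *)
Require Import Defs.
From mathcomp Require Import all_boot zify.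

Set Implicit Arguments.
Unset Strict Implicit.
Unset Printing Implicit Defensive.

(* All counts are over ordered pairs of distinct vertices.  Let S be the number
   of non-adjacent pairs of H, and let S_v and B_v be the numbers of pairs of
   H \ v at distance at least 2 and at least 3.  A connected 4-uniform hypergraph
   of order at most 8 has diameter at most 3, so with n = 9 the condition
   W(H \ v) = W(H) reads S_v + B_v = t + 2 (n - 1), where
   t = 2 W(H) - n (n - 1) >= S.  Call a third vertex a separator of a pair if it lies
   in every edge through the pair: an adjacent pair has at most 2 separators, a
   non-adjacent one has n - 2.  Hence sum_v S_v = 2 n (n - 1) + (n - 4) S - D,
   where D counts the separators that adjacent pairs lack to have 2 each, and
   summing the condition over v gives sum_v B_v >= 4 t + D.

   Take v with 9 B_v >= 4 t + D.  If B_v = 0, then S = D = 0 and H is a Steiner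
   system S(2,4,9), which does not exist because 3 does not divide 8.  Otherwise
   some x, y are at distance 3 in H \ v; their closed neighbourhoods there are
   disjoint, hence are single edges A and B that partition V \ v, and x, y lie in
   no other edge avoiding v.  After labelling A = 0123, B = 4567, v = 8, x = 0,
   y = 4, a branch-and-bound search over the remaining edges shows that
   9 B_v >= 4 t + D and t >= S cannot both hold: D increases and S, S_v, B_v
   decrease with the edge set. *)

Lemma leq_b2n (b c : bool) : (b -> c) -> b <= c.
Proof. by case: b => // ->. Qed.

(** * Sums over ordered pairs of distinct vertices *)

Section PairSum.
Variable V : eqType.
Implicit Types (s : seq V) (f g : V -> V -> nat).

Definition others s x : seq V := [seq y <- s | y != x].

Definition pairsum s f : nat := sumn [seq sumn [seq f x y | y <- others s x] | x <- s].

Lemma mem_others s x y : (y \in others s x) = (y != x) && (y \in s).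
Proof. exact: mem_filter. Qed.

Lemma others_sub s x : {subset others s x <= s}.
Proof. exact/mem_subseq/filter_subseq. Qed.

Lemma others_uniq s x : uniq s -> uniq (others s x).
Proof. exact: filter_uniq. Qed.

Lemma othersC s x y : others (others s x) y = others (others s y) x.
Proof. by rewrite /others -!filter_predI; apply: eq_filter => z; rewrite /= andbC. Qed.

Lemma count_others s x a : uniq s -> x \in s -> count a s = a x + count a (others s x).
Proof.
by move=> s_uniq xs; rewrite -[others s x]rem_filter // (permP (perm_to_rem xs)).
Qed.

Lemma size_others s x : uniq s -> x \in s -> size (others s x) = (size s).-1.
Proof. by move=> s_uniq xs; rewrite -[others s x]rem_filter // size_rem. Qed.

Lemma exchange_others s f :
  \sum_(x <- s) \sum_(y <- others s x) f x y
  = \sum_(y <- s) \sum_(x <- others s y) f x y.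
Proof.
under eq_bigr do rewrite big_filter big_mkcond.
rewrite exchange_big; apply: eq_bigr => y _.
by rewrite big_filter [RHS]big_mkcond; apply: eq_bigr => x _; rewrite eq_sym.
Qed.

Lemma pairsumE s f : pairsum s f = \sum_(x <- s) \sum_(y <- others s x) f x y.
Proof.
by rewrite /pairsum sumnE big_map; apply: eq_bigr => x _; rewrite sumnE big_map.
Qed.

Lemma eq_pairsum s f g : (forall x y, x \in s -> y \in others s x -> f x y = g x y) ->
  pairsum s f = pairsum s g.
Proof.
move=> fg; rewrite !pairsumE; apply: eq_big_seq => x xs.
by apply: eq_big_seq => y; apply: fg.
Qed.

Lemma leq_pairsum s f g : (forall x y, x \in s -> y \in others s x -> f x y <= g x y) ->
  pairsum s f <= pairsum s g.
Proof.
move=> fg; rewrite !pairsumE big_seq [leqRHS]big_seq; apply: leq_sum => x xs.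
by rewrite big_seq [leqRHS]big_seq; apply: leq_sum => y; apply: fg.
Qed.

Lemma pairsumD s f g : pairsum s (fun x y => f x y + g x y) = pairsum s f + pairsum s g.
Proof. by rewrite !pairsumE -big_split; apply: eq_bigr => x _; rewrite big_split. Qed.

Lemma pairsumM s c f : pairsum s (fun x y => c * f x y) = c * pairsum s f.
Proof. by rewrite !pairsumE big_distrr; apply: eq_bigr => x _; rewrite big_distrr. Qed.

Lemma pairsum_const s c : uniq s ->
  pairsum s (fun _ _ => c) = size s * (size s).-1 * c.
Proof.
move=> s_uniq; rewrite pairsumE (eq_big_seq (fun _ => (size s).-1 * c)) => [|x xs].
  by rewrite big_const_seq count_predT iter_addn_0 mulnC mulnA.
by rewrite big_const_seq count_predT iter_addn_0 size_others // mulnC.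
Qed.

Lemma pairsum_eq0 s f :
  (pairsum s f == 0) = all (fun x => all (fun y => f x y == 0) (others s x)) s.
Proof.
by rewrite pairsumE sum_nat_seq_eq0; apply: eq_all => x; rewrite sum_nat_seq_eq0.
Qed.

Lemma perm_pairsum s t f : perm_eq s t -> pairsum s f = pairsum t f.
Proof.
move=> st; rewrite !pairsumE (perm_big t) //=; apply: eq_bigr => x _.
exact/perm_big/perm_filter.
Qed.

End PairSum.

Lemma others_map (V W : eqType) (h : V -> W) (s : seq V) x :
  {in s &, injective h} -> x \in s -> others (map h s) (h x) = map h (others s x).
Proof.
move=> h_inj xs; rewrite /others filter_map; congr map.
by apply: eq_in_filter => y ys; rewrite /= (inj_in_eq h_inj).
Qed.

Lemma pairsum_map (V W : eqType) (h : V -> W) (s : seq V) (f : W -> W -> nat) :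
  {in s &, injective h} -> pairsum (map h s) f = pairsum s (fun x y => f (h x) (h y)).
Proof.
move=> h_inj; rewrite !pairsumE big_map; apply: eq_big_seq => x xs.
by rewrite others_map // big_map.
Qed.

Lemma pairsum_enum (T : finType) (A : {set T}) (f : T -> T -> nat) :
  (forall x y, f x y = f y x) ->
  pairsum (enum A) f =
  2 * \sum_(p : T * T | [&& p.1 \in A, p.2 \in A & enum_rank p.1 < enum_rank p.2])
        f p.1 p.2.
Proof.
move=> fC; rewrite pairsumE big_enum /=.
under eq_bigr do rewrite big_filter big_enum_cond.
rewrite pair_big_dep /= (bigID (fun p : T * T => enum_rank p.1 < enum_rank p.2)) /=.
rewrite mul2n -addnn; congr (_ + _).
  apply: eq_bigl => -[x y] /=; case: (x \in A) (y \in A) => [] [] //=.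
  by case: eqVneq => [->|]; rewrite ?ltnn.
pose swap (p : T * T) := (p.2, p.1).
rewrite (reindex_inj (h := swap)) /=; last by move=> [? ?] [? ?] [-> ->].
apply: eq_big => -[x y] /=; last by rewrite fC.
case: (x \in A) (y \in A) => [] [] //=.
by rewrite -(inj_eq enum_rank_inj) -val_eqE -leqNgt (ltn_neqAle (enum_rank x)) //.
Qed.

(** * Incidence structures given by lists *)

Section Incidence.
Variables (V E : eqType) (inc : V -> E -> bool).
Implicit Types (s : seq V) (C : seq E).

Definition edges_through C x y : seq E := [seq e <- C | inc x e && inc y e].

Definition edges_avoiding v C : seq E := [seq e <- C | ~~ inc v e].

Definition adj C x y : bool := has (fun e => inc x e && inc y e) C.

Definition far s C x y : bool := ~~ has (fun z => adj C x z && adj C z y) s.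

(* The number of vertices whose deletion leaves [x] and [y] non-adjacent; if no edge
   contains both, every other vertex counts. *)
Definition separators s C x y : nat :=
  let L := edges_through C x y in
  count (fun z => all (inc z) L) (others (others s x) y).

Definition nonadjs s C : nat := pairsum s (fun x y => ~~ adj C x y).

Definition fars s C : nat := pairsum s (far s C).

Definition deficit k s C : nat := pairsum s (fun x y => k - 2 - separators s C x y).

Definition nonadjs_del s C v : nat := nonadjs (others s v) (edges_avoiding v C).

Definition fars_del s C v : nat := fars (others s v) (edges_avoiding v C).

Section Monotonicity.
Variables C U : seq E.
Hypothesis CU : {subset C <= U}.

Lemma adjS x y : adj C x y -> adj U x y.
Proof. by case/hasP=> e /CU eU xye; apply/hasP; exists e. Qed.

Lemma nonadjsS s : nonadjs s U <= nonadjs s C.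
Proof. by apply: leq_pairsum => x y _ _; apply/leq_b2n/contra/adjS. Qed.

Lemma farsS s : fars s U <= fars s C.
Proof.
apply: leq_pairsum => x y _ _; apply/leq_b2n/contra.
by apply: sub_has => z /andP[/adjS -> /adjS ->].
Qed.

Lemma deficitS k s : deficit k s C <= deficit k s U.
Proof.
apply: leq_pairsum => x y _ _; apply/leq_sub2l/sub_count => z /allP zU.
apply/allP => e; rewrite mem_filter => /andP[xye /CU eU].
by apply: zU; rewrite mem_filter xye.
Qed.

Lemma edges_avoidingS v : {subset edges_avoiding v C <= edges_avoiding v U}.
Proof. by move=> e; rewrite !mem_filter => /andP[-> /CU]. Qed.

End Monotonicity.

Lemma perm_fars s t C : perm_eq s t -> fars s C = fars t C.
Proof.
move=> st; rewrite /fars (perm_pairsum _ st); apply: eq_pairsum => x y _ _.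
by rewrite /far (eq_has_r (perm_mem st)).
Qed.

Lemma perm_deficit k s t C : perm_eq s t -> deficit k s C = deficit k t C.
Proof.
move=> st; rewrite /deficit (perm_pairsum _ st); apply: eq_pairsum => x y _ _.
by congr (_ - _); apply/permP/perm_filter/perm_filter.
Qed.

End Incidence.

Section Relabelling.
Variables (V V' E E' : eqType) (inc : V -> E -> bool) (inc' : V' -> E' -> bool).
Variables (h : V' -> V) (g : E -> E') (s : seq V').
Hypothesis h_inj : {in s &, injective h}.
Hypothesis inc_g : forall x e, x \in s -> inc' x (g e) = inc (h x) e.
Implicit Type C : seq E.

Lemma adj_relabel C x y : x \in s -> y \in s ->
  adj inc' (map g C) x y = adj inc C (h x) (h y).
Proof.
by move=> xs ys; rewrite /adj has_map; apply: eq_has => e /=; rewrite !inc_g.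
Qed.

Lemma nonadjs_relabel C : nonadjs inc' s (map g C) = nonadjs inc (map h s) C.
Proof.
rewrite /nonadjs pairsum_map //; apply: eq_pairsum => x y xs /others_sub ys.
by rewrite adj_relabel.
Qed.

Lemma fars_relabel C : fars inc' s (map g C) = fars inc (map h s) C.
Proof.
rewrite /fars pairsum_map //; apply: eq_pairsum => x y xs /others_sub ys.
rewrite /far has_map; congr (nat_of_bool (~~ _)).
by apply: eq_in_has => z zs; rewrite /= !adj_relabel.
Qed.

Lemma separators_relabel C x y : x \in s -> y \in others s x ->
  separators inc' s (map g C) x y = separators inc (map h s) C (h x) (h y).
Proof.
move=> xs yx; have ys := others_sub yx.
have h_inj_x : {in others s x &, injective h}.
  by move=> z w /others_sub zs /others_sub ws; apply: h_inj.
rewrite /separators !others_map // count_map; apply: eq_in_count => z.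
move=> /others_sub/others_sub zs; rewrite /= /edges_through filter_map all_map.
rewrite (eq_filter (a2 := fun e => inc (h x) e && inc (h y) e)); last first.
  by move=> e /=; rewrite !inc_g.
by apply: eq_all => e; apply: inc_g.
Qed.

Lemma deficit_relabel k C : deficit inc' k s (map g C) = deficit inc k (map h s) C.
Proof.
rewrite /deficit pairsum_map //; apply: eq_pairsum => x y xs ys.
by rewrite separators_relabel.
Qed.

Lemma edges_avoiding_relabel C v : v \in s ->
  edges_avoiding inc' v (map g C) = map g (edges_avoiding inc (h v) C).
Proof.
move=> vs; rewrite /edges_avoiding filter_map; congr map.
by apply: eq_filter => e /=; rewrite inc_g.
Qed.

End Relabelling.

(** * Counting over vertex deletions *)

Section UniformCounting.
Variables (V E : eqType) (inc : V -> E -> bool) (k : nat) (s : seq V) (C : seq E).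
Hypothesis s_uniq : uniq s.
Hypothesis C_uniform : {in C, forall e, count (inc^~ e) s = k}.

Local Notation n := (size s).

Lemma all_edges_through x y z :
  all (inc z) (edges_through inc C x y) = ~~ adj inc (edges_avoiding inc z C) x y.
Proof.
rewrite -all_predC /edges_through /edges_avoiding !all_filter; apply: eq_all => e /=.
by case: (inc x e && _) (inc z e) => [] [].
Qed.

Lemma sum_nonadjs_del :
  \sum_(v <- s) nonadjs_del inc s C v = pairsum s (separators inc s C).
Proof.
under eq_bigr do rewrite /nonadjs_del /nonadjs pairsumE.
rewrite exchange_others pairsumE; apply: eq_bigr => x _.
under eq_bigr do rewrite othersC.
rewrite exchange_others; apply: eq_bigr => y _.
rewrite /separators -sum1_count [RHS]big_mkcond; apply: eq_bigr => z _.
by rewrite all_edges_through; case: ifP.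
Qed.

Lemma count_edge_others x y e : e \in C -> x \in s -> y \in others s x ->
  inc x e -> inc y e -> count (inc^~ e) (others (others s x) y) = k - 2.
Proof.
move=> eC xs yx xe ye; rewrite -(C_uniform eC) (count_others _ s_uniq xs).
by rewrite (count_others _ (others_uniq x s_uniq) yx) xe ye addnA addKn.
Qed.

Lemma separators_adj x y : x \in s -> y \in others s x -> adj inc C x y ->
  separators inc s C x y <= k - 2.
Proof.
move=> xs yx /hasP[e eC /andP[xe ye]]; rewrite -(count_edge_others eC xs yx) //.
by apply: sub_count => z /allP/(_ e); apply; rewrite mem_filter xe ye.
Qed.

Lemma separators_nonadj x y : x \in s -> y \in others s x -> ~~ adj inc C x y ->
  separators inc s C x y = n - 2.
Proof.
move=> xs yx; rewrite /adj has_filter negbK => /eqP no_edge.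
rewrite /separators /edges_through no_edge /= count_predT.
by rewrite !size_others ?others_uniq // -subn2.
Qed.

Lemma separators_deficit : 1 < k <= n -> forall x y, x \in s -> y \in others s x ->
  separators inc s C x y + (k - 2 - separators inc s C x y)
  = k - 2 + (n - k) * ~~ adj inc C x y.
Proof.
move=> kn x y xs yx; case: (boolP (adj inc C x y)) => [xy|nxy].
  by have := separators_adj xs yx xy; lia.
by rewrite separators_nonadj //; lia.
Qed.

Lemma sum_nonadjs_del_deficit : 1 < k <= n ->
  \sum_(v <- s) nonadjs_del inc s C v + deficit inc k s C
  = n * n.-1 * (k - 2) + (n - k) * nonadjs inc s C.
Proof.
move=> kn; rewrite sum_nonadjs_del -pairsumD (eq_pairsum (separators_deficit kn)).
by rewrite pairsumD pairsum_const // pairsumM.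
Qed.

End UniformCounting.

Lemma exists_geq_mean (V : eqType) (s : seq V) (F : V -> nat) :
  0 < size s -> exists2 v, v \in s & \sum_(x <- s) F x <= size s * F v.
Proof.
move=> s_gt0; pose above_mean v := \sum_(x <- s) F x <= size s * F v.
have [/hasP[v vs v_above]|/hasPn none_above] := boolP (has above_mean s).
  by exists v.
have : \sum_(v <- s) (size s * F v).+1 <= \sum_(v <- s) \sum_(x <- s) F x.
  rewrite big_seq [leqRHS]big_seq; apply: leq_sum => v /none_above.
  by rewrite /above_mean -ltnNge.
rewrite big_const_seq count_predT iter_addn_0.
under eq_bigr do rewrite -addn1.
by rewrite big_split -big_distrr sum1_size /=; lia.
Qed.

Lemma sum_fars_del_geq (V E : eqType) (inc : V -> E -> bool) (s : seq V) (C : seq E) t :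
  uniq s -> {in C, forall e, count (inc^~ e) s = 4} -> 3 < size s ->
  nonadjs inc s C <= t ->
  {in s, forall v, nonadjs_del inc s C v + fars_del inc s C v = t + 2 * (size s).-1} ->
  4 * t + deficit inc 4 s C <= \sum_(v <- s) fars_del inc s C v.
Proof.
move=> s_uniq C4 s_gt3 S_le_t del_t.
have := sum_nonadjs_del_deficit s_uniq C4 s_gt3.
have : \sum_(v <- s) (nonadjs_del inc s C v + fars_del inc s C v)
    = size s * (t + 2 * (size s).-1).
  by rewrite (eq_big_seq _ del_t) big_const_seq count_predT iter_addn_0 mulnC.
rewrite big_split /= => sum_del sum_def.
have : (size s - 4) * nonadjs inc s C + 4 * t <= size s * t.
  by rewrite -{2}(subnK s_gt3) mulnDl leq_add2r leq_mul2l S_le_t orbT.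
by lia.
Qed.

Section Steiner.
Variables (V E : eqType) (inc : V -> E -> bool) (k : nat) (s : seq V) (C : seq E).
Hypotheses (s_uniq : uniq s) (C_uniq : uniq C).
Hypothesis C_uniform : {in C, forall e, count (inc^~ e) s = k}.
Hypothesis C_ext : {in C &, forall e f, {in s, inc^~ e =1 inc^~ f} -> e = f}.

(* The edges through [v] split the other vertices into blocks of [k - 1]. *)
Lemma steiner_dvdn v : v \in s ->
  {in others s v, forall y, size (edges_through inc C v y) = 1} ->
  k.-1 %| (size s).-1.
Proof.
move=> vs one_edge.
have <- : \sum_(y <- others s v) size (edges_through inc C v y) = (size s).-1.
  by rewrite (eq_big_seq _ one_edge) sum1_size size_others.
under eq_bigr do rewrite size_filter -sum1_count big_mkcond.
rewrite exchange_big big_seq; apply: dvdn_sum => e eC /=.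
rewrite -big_mkcond sum1_count; case: (boolP (inc v e)) => [ve|_] /=.
  by rewrite -(C_uniform eC) (count_others _ s_uniq vs) ve.
by rewrite count_pred0.
Qed.

(* An edge through [x] and [y] has [k - 2] other vertices, which include all the
   separators. *)
Lemma inc_edges_through x y e : x \in s -> y \in others s x ->
  k - 2 <= separators inc s C x y -> e \in edges_through inc C x y ->
  {in others (others s x) y, forall z, inc z e = all (inc z) (edges_through inc C x y)}.
Proof.
move=> xs yx sep_geq eL z zxy; have := eL; rewrite mem_filter => /andP[/andP[xe ye] eC].
set L := edges_through inc C x y in sep_geq eL *.
have sub : {subset [seq w <- others (others s x) y | all (inc w) L]
              <= [seq w <- others (others s x) y | inc w e]}.
  by move=> w; rewrite !mem_filter => /andP[/allP/(_ e eL) -> ->].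
have xy_uniq := others_uniq y (others_uniq x s_uniq).
have [|_ /(_ z)] := uniq_min_size (filter_uniq _ xy_uniq) sub.
  by rewrite !size_filter (count_edge_others s_uniq C_uniform).
by move: zxy; rewrite !mem_filter => ->; rewrite !andbT => ->.
Qed.

Lemma size_edges_through_eq1 x y : x \in s -> y \in others s x ->
  adj inc C x y -> k - 2 <= separators inc s C x y ->
  size (edges_through inc C x y) = 1.
Proof.
move=> xs yx /hasP[e eC xye] sep_geq; set L := edges_through inc C x y.
have eL : e \in L by rewrite mem_filter xye.
have L_eq f : f \in L -> f = e.
  move=> fL; have := fL; rewrite mem_filter => /andP[/andP[xf yf] fC].
  apply: C_ext => // z zs; have [xe ye] := andP xye.
  have [->|zx] := eqVneq z x; first by rewrite xf xe.
  have [->|zy] := eqVneq z y; first by rewrite yf ye.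
  by rewrite !(inc_edges_through xs yx sep_geq) // !mem_others zx zy.
apply: (@perm_size _ L [:: e]); apply: uniq_perm => [|//|f]; first exact: filter_uniq.
by rewrite mem_seq1; apply/idP/eqP => [/L_eq|->].
Qed.

Lemma nonadjs0_deficit0_dvdn : 0 < size s ->
  nonadjs inc s C = 0 -> deficit inc k s C = 0 -> k.-1 %| (size s).-1.
Proof.
move=> s_gt0 /eqP; rewrite pairsum_eq0 => /allP adj_s /eqP.
rewrite pairsum_eq0 => /allP sep_s.
have /hasP[v vs _] : has predT s by rewrite has_predT.
apply: (steiner_dvdn vs) => y yv; apply: size_edges_through_eq1 => //.
  by move/allP: (adj_s v vs) => /(_ y yv); rewrite eqb0 negbK.
by move/allP: (sep_s v vs) => /(_ y yv); rewrite subn_eq0.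
Qed.

End Steiner.

(** * Distances and the Wiener index *)

Lemma big_eadd_Some (I : finType) (P : pred I) (F : I -> enat) (g : I -> nat) :
  (forall i, P i -> F i = Some (g i)) ->
  \big[eadd/Some 0]_(i | P i) F i = Some (\sum_(i | P i) g i).
Proof. by move=> FE; elim/big_rec2: _ => // i m n Pi ->; rewrite FE. Qed.

Lemma big_eadd_None (I : finType) (P : pred I) (F : I -> enat) i :
  P i -> F i = None -> \big[eadd/Some 0]_(i | P i) F i = None.
Proof. by move=> Pi Fi; rewrite (bigD1 i) //= Fi. Qed.

Definition inset (T : finType) (x : T) (A : {set T}) : bool := x \in A.
Arguments inset T x A : clear implicits.

Local Notation vertices H := (enum (hverts H)).
Local Notation edges H := (enum (hedges H)).

Section Distances.
Variables (T : finType) (H : hypergraph T).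

Lemma edge_sub e : e \in hedges H -> e \subset hverts H.
Proof. exact: (forall_inP (hedges_sub H)). Qed.

Lemma hadjE x y : hadj H x y = adj (inset T) (edges H) x y.
Proof.
apply/existsP/hasP => [[e /andP[eH xye]]|[e eH xye]]; exists e; rewrite ?mem_enum //.
by rewrite -mem_enum eH.
Qed.

Lemma hadjP x y :
  reflect (exists e, [/\ e \in hedges H, x \in e & y \in e]) (hadj H x y).
Proof.
apply: (iffP existsP) => -[e]; first by case/and3P; exists e.
by case=> eH xe ye; exists e; rewrite eH xe.
Qed.

Lemma hadj_vert x y : hadj H x y -> y \in hverts H.
Proof. by case/hadjP=> e [/edge_sub/subsetP eV _ /eV]. Qed.

Lemma hadj_refl x y : hadj H x y -> hadj H y y.
Proof. by case/hadjP=> e [eH _ ye]; apply/hadjP; exists e. Qed.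

Lemma hwalkP x y l :
  reflect (exists p, [/\ size p = l, path (hadj H) x p & last x p = y]) (hwalk H x y l).
Proof.
apply: (iffP existsP) => [[p /andP[xp /eqP py]]|[p [<- xp py]]].
  by exists p; rewrite size_tuple.
by exists (in_tuple p); rewrite xp py /=.
Qed.

Lemma hwalk0 x y : hwalk H x y 0 = (x == y).
Proof. by apply/hwalkP/eqP => [[p [/size0nil -> _]] //|->]; exists [::]. Qed.

Lemma adj_hwalk x y : adj (inset T) (edges H) x y = hwalk H x y 1.
Proof.
rewrite -hadjE; apply/idP/hwalkP => [xy|[p [size_p xp <-]]].
  by exists [:: y]; rewrite /= xy.
by case: p size_p xp => [|z []] //= _; rewrite andbT.
Qed.

Lemma far_hwalk x y : far (inset T) (vertices H) (edges H) x y = ~~ hwalk H x y 2.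
Proof.
congr (~~ _); apply/hasP/hwalkP => [[z _]|[p [size_p xp <-]]].
  by rewrite -!hadjE => /andP[xz zy]; exists [:: z; y]; rewrite /= xz zy.
case: p size_p xp => [|z [|z' []]] //= _ /and3P[xz zz' _].
by exists z; rewrite ?mem_enum ?(hadj_vert xz) // -!hadjE xz.
Qed.

Lemma hwalkS x y l : hwalk H x y l.+1 -> hwalk H x y l.+2.
Proof.
case/hwalkP=> p []; case/lastP: p => // p z; rewrite last_rcons rcons_path => sp.
case/andP=> xp pz zy; apply/hwalkP; exists (rcons (rcons p z) z).
by rewrite size_rcons sp !rcons_path !last_rcons xp pz (hadj_refl pz).
Qed.

Lemma hwalk_hdist x y l m :
  hdist H x y = Some l -> x != y -> hwalk H x y m = (l <= m).
Proof.
case/hdist_Some=> xyl min_l xy; apply/idP/idP => [/min_l //|]; elim: m => [|m IHm].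
  by rewrite leqn0 => /eqP <-.
rewrite leq_eqVlt => /predU1P[<- //|/IHm]; case: m {IHm} => [|m]; last exact: hwalkS.
by rewrite hwalk0 (negPf xy).
Qed.

Lemma hdist_geq x y l : hdist H x y = Some l -> x != y ->
  1 + ~~ adj (inset T) (edges H) x y + far (inset T) (vertices H) (edges H) x y <= l.
Proof.
move=> xyl xy; rewrite adj_hwalk far_hwalk !(hwalk_hdist _ xyl) //.
have : ~~ hwalk H x y 0 by rewrite hwalk0.
by rewrite (hwalk_hdist _ xyl) //; lia.
Qed.

Lemma hdist_hwalk3 x y l : hdist H x y = Some l -> x != y -> hwalk H x y 3 ->
  l = 1 + ~~ adj (inset T) (edges H) x y + far (inset T) (vertices H) (edges H) x y.
Proof.
move=> xyl xy; have := hdist_geq xyl xy.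
by rewrite adj_hwalk far_hwalk !(hwalk_hdist _ xyl) //; lia.
Qed.

Lemma hconnected_hdist x y :
  hconnected H -> x \in hverts H -> y \in hverts H -> exists l, hdist H x y = Some l.
Proof. by move=> con xV yV; case: hdist (con x y xV yV) => // l _; exists l. Qed.

Lemma wiener_pairsum : hconnected H ->
  exists2 w, wiener H = Some w
           & 2 * w = pairsum (vertices H) (fun x y => odflt 0 (hdist H x y)).
Proof.
move=> con; eexists; last by rewrite pairsum_enum // => x y; rewrite hdistC.
apply: big_eadd_Some => -[x y] /= /and3P[xV yV _].
by have [l ->] := hconnected_hdist con xV yV.
Qed.

Lemma wiener_connected w : wiener H = Some w -> hconnected H.
Proof.
move=> wE x y xV yV xy_inf.
have rank_le a b : a \in hverts H -> b \in hverts H -> hdist H a b = None ->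
    enum_rank b <= enum_rank a.
  move=> aV bV ab_inf; rewrite leqNgt; apply/negP => ab.
  suff wN : wiener H = None by rewrite wN in wE.
  by apply: (@big_eadd_None _ _ _ (a, b)); rewrite //= aV bV ab.
have xy : x = y.
  by apply/enum_rank_inj/val_inj/eqP; rewrite eqn_leq !rank_le // hdistC.
have /hdist_None/(_ 0)/negP[] := xy_inf.
by rewrite hwalk0 xy.
Qed.

Lemma wiener_geq w : wiener H = Some w ->
  horder H * (horder H).-1 + nonadjs (inset T) (vertices H) (edges H) <= 2 * w.
Proof.
move=> wE; have con := wiener_connected wE; have [w'] := wiener_pairsum con.
rewrite wE => -[<-] ->; rewrite /horder cardE.
rewrite -[_ * _]muln1 -pairsum_const ?enum_uniq // -pairsumD.
apply: leq_pairsum => x y; rewrite mem_others !mem_enum => xV /andP[yx yV].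
have [l dE] := hconnected_hdist con xV yV; rewrite dE.
by apply: leq_trans (leq_addr _ _) (hdist_geq dE _); rewrite eq_sym.
Qed.

Lemma wiener_diameter3 w : wiener H = Some w ->
  {in hverts H &, forall x y, x != y -> hwalk H x y 3} ->
  2 * w = horder H * (horder H).-1
          + (nonadjs (inset T) (vertices H) (edges H)
             + fars (inset T) (vertices H) (edges H)).
Proof.
move=> wE diam3; have con := wiener_connected wE; have [w'] := wiener_pairsum con.
rewrite wE => -[<-] ->; rewrite /horder cardE.
rewrite -[_ * _]muln1 -pairsum_const ?enum_uniq // addnA -!pairsumD.
apply: eq_pairsum => x y; rewrite mem_others !mem_enum eq_sym => xV /andP[xy yV].
have [l dE] := hconnected_hdist con xV yV; rewrite dE.
exact: hdist_hwalk3 dE xy (diam3 x y xV yV xy).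
Qed.

Lemma hconnected_edge x y :
  hconnected H -> x \in hverts H -> y \in hverts H -> x != y ->
  exists2 e, e \in hedges H & x \in e.
Proof.
move=> con xV yV xy.
have [l /hdist_Some[/hwalkP[p [_ xp py]] _]] := hconnected_hdist con xV yV.
case: p xp py => [|z p] /=; first by move=> _ /eqP; rewrite (negPf xy).
by case/andP=> /hadjP[e [eH xe _]]; exists e.
Qed.

Lemma path_exit (A : {set T}) x p :
  path (hadj H) x p -> x \in A -> last x p \notin A ->
  exists a b, [/\ a \in A, b \notin A & hadj H a b].
Proof.
elim: p x => [|y p IHp] x /=; first by move=> _ ->.
case/andP=> xy yp xA; case: (boolP (y \in A)) => [yA|yA _]; first exact: IHp.
by exists x, y.
Qed.

Lemma hconnected_exit (A : {set T}) x y :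
  hconnected H -> x \in hverts H -> y \in hverts H -> x \in A -> y \notin A ->
  exists a b, [/\ a \in A, b \notin A & hadj H a b].
Proof.
move=> con xV yV xA yA.
have [l /hdist_Some[/hwalkP[p [_ xp py]] _]] := hconnected_hdist con xV yV.
by apply: (path_exit xp) => //; rewrite py.
Qed.

End Distances.

Record antipodal (T : finType) (H : hypergraph T) (x y : T) (A B : {set T}) : Prop :=
  Antipodal {
    antipodal_edges : A \in hedges H /\ B \in hedges H;
    antipodal_mem : x \in A /\ y \in B;
    antipodal_disjoint : [disjoint A & B];
    antipodal_cover : A :|: B = hverts H;
    antipodal_uniqueA : forall e, e \in hedges H -> x \in e -> e = A;
    antipodal_uniqueB : forall e, e \in hedges H -> y \in e -> e = B;
    antipodal_crossing : exists2 e, e \in hedges H & (x \notin e) && (y \notin e)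
  }.

Section OrderAtMostTwiceUniformity.
Variables (T : finType) (H : hypergraph T) (k : nat).
Hypotheses (order_le : horder H <= k.*2) (uniformH : uniform H k).
Hypothesis con : hconnected H.

Lemma disjoint_edges_cover A B : A \in hedges H -> B \in hedges H ->
  [disjoint A & B] -> A :|: B = hverts H.
Proof.
move=> AH BH dAB; apply/eqP; rewrite eqEcard subUset !edge_sub //=.
have [_] := leq_card_setU A B; rewrite dAB (uniformH AH) (uniformH BH) addnn.
by move/eqP->.
Qed.

Lemma hwalk3 x y : x \in hverts H -> y \in hverts H -> x != y -> hwalk H x y 3.
Proof.
move=> xV yV xy; have [A AH xA] := hconnected_edge con xV yV xy.
have [B BH yB] : exists2 B, B \in hedges H & y \in B.
  by apply: (hconnected_edge con yV xV); rewrite eq_sym.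
have adjA a b : a \in A -> b \in A -> hadj H a b by move=> aA bA; apply/hadjP; exists A.
have adjB a b : a \in B -> b \in B -> hadj H a b by move=> aB bB; apply/hadjP; exists B.
case: (boolP [disjoint A & B]) => [dAB|].
  have yA : y \notin A by rewrite (disjointFl dAB).
  have [a [b [aA bA ab]]] := hconnected_exit con xV yV xA yA.
  have bB : b \in B.
    by have := hadj_vert ab; rewrite -(disjoint_edges_cover AH BH dAB) inE (negPf bA).
  by apply/hwalkP; exists [:: a; b; y]; rewrite /= ab adjA ?adjB.
rewrite -setI_eq0 => /set0Pn[z]; rewrite inE => /andP[zA zB].
by apply/hwalkP; exists [:: x; z; y]; rewrite /= (adjA x x) ?(adjA x z) ?adjB.
Qed.

Lemma far_antipodal x y : x \in hverts H -> y \in hverts H -> x != y ->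
  far (inset T) (vertices H) (edges H) x y ->
  exists A B, antipodal H x y A B.
Proof.
move=> xV yV xy; rewrite far_hwalk => /hwalkP no_walk2.
have [A AH xA] := hconnected_edge con xV yV xy.
have [B BH yB] : exists2 B, B \in hedges H & y \in B.
  by apply: (hconnected_edge con yV xV); rewrite eq_sym.
have disj e f : e \in hedges H -> f \in hedges H -> x \in e -> y \in f ->
    [disjoint e & f].
  move=> eH fH xe yf; rewrite -setI_eq0; apply/set0Pn => -[z].
  rewrite inE => /andP[ze zf]; apply: no_walk2; exists [:: z; y].
  by split=> //=; rewrite andbT; apply/andP; split; apply/hadjP; [exists e|exists f].
have compl e f : e \in hedges H -> f \in hedges H -> x \in e -> y \in f ->
    e = hverts H :\: f /\ f = hverts H :\: e.
  move=> eH fH xe yf; have ef := disj e f eH fH xe yf.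
  rewrite -(disjoint_edges_cover eH fH ef) !setDUl !setDv setU0 set0U.
  by split; apply/esym/setDidPl; rewrite // disjoint_sym.
have uniqA e : e \in hedges H -> x \in e -> e = A.
  by move=> eH xe; rewrite (compl e B eH BH xe yB).1 -(compl A B AH BH xA yB).1.
have uniqB e : e \in hedges H -> y \in e -> e = B.
  by move=> eH ye; rewrite (compl A e AH eH xA ye).2 -(compl A B AH BH xA yB).2.
have dAB := disj A B AH BH xA yB; exists A, B; split=> //.
  exact: disjoint_edges_cover.
have yA : y \notin A by rewrite (disjointFl dAB).
have [a [b [aA bA /hadjP[e [eH ae be]]]]] := hconnected_exit con xV yV xA yA.
exists e => //; apply/andP; split; apply/negP.
  by move=> /(uniqA e eH) eA; rewrite -eA be in bA.
by move=> /(uniqB e eH) eB; rewrite eB (disjointFr dAB aA) in ae.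
Qed.

End OrderAtMostTwiceUniformity.

(** * Numerical constraints on a Soltés hypergraph *)

Section Feasibility.
Variables (V E : eqType) (inc : V -> E -> bool).
Implicit Types (s : seq V) (v : V) (C U X : seq E).

(* The inequalities [4 t + D <= n B_v] and [S <= t], where
   [t = S_v + B_v - 2 (n - 1)], with each term replaced by the bound that [C] and
   [U] give for an edge set between them.  The virtual machine would evaluate both
   arguments of [&&], hence [if]. *)
Definition feasible s v C U : bool :=
  let b := fars_del inc s C v in
  if 4 * (nonadjs_del inc s U v + fars_del inc s U v) + deficit inc 4 s C
       <= size s * b + 8 * (size s).-1
  then nonadjs inc s U + 2 * (size s).-1 <= nonadjs_del inc s C v + b
  else false.

Lemma feasibleS s v C X U : {subset C <= X} -> {subset X <= U} ->
  feasible s v X X -> feasible s v C U.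
Proof.
move=> CX XU /andP[sum_le nonadjs_le]; apply/andP.
have CXv := edges_avoidingS (inc := inc) CX (v := v).
have XUv := edges_avoidingS (inc := inc) XU (v := v).
have := nonadjsS inc XU s; have := deficitS inc CX 4 s.
have := nonadjsS inc CXv (others s v); have := nonadjsS inc XUv (others s v).
have := farsS inc CXv (others s v); have := farsS inc XUv (others s v).
rewrite -!/(nonadjs_del _ _ _ _) -!/(fars_del _ _ _ _).
move=> farsU farsC nonadjsU nonadjsC deficitC nonadjs_all.
have := leq_mul (leqnn (size s)) farsC.
by split; lia.
Qed.

Lemma perm_feasible s t v C U : perm_eq s t -> feasible s v C U = feasible t v C U.
Proof.
move=> st; have st_v : perm_eq (others s v) (others t v) by apply: perm_filter.
rewrite /feasible /nonadjs_del /fars_del /nonadjs !(perm_pairsum _ st) (perm_size st).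
by rewrite !(perm_pairsum _ st_v) !(perm_fars _ _ st_v) (perm_deficit _ _ _ st).
Qed.

Lemma exists_feasible s C t :
  uniq s -> {in C, forall e, count (inc^~ e) s = 4} -> 3 < size s ->
  nonadjs inc s C <= t ->
  {in s, forall v, nonadjs_del inc s C v + fars_del inc s C v = t + 2 * (size s).-1} ->
  exists2 v, v \in s & feasible s v C C.
Proof.
move=> s_uniq C4 s_gt3 S_le_t del_t.
have s_gt0 : 0 < size s by apply: ltn_trans s_gt3.
have [v vs mean_v] := exists_geq_mean (fars_del inc s C) s_gt0.
have sum_geq := leq_trans (sum_fars_del_geq s_uniq C4 s_gt3 S_le_t del_t) mean_v.
by exists v => //; rewrite /feasible del_t //; apply/andP; split; lia.
Qed.

Lemma feasible_fars_del_gt0 s v C : uniq s -> uniq C ->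
  {in C, forall e, count (inc^~ e) s = 4} ->
  {in C &, forall e f, {in s, inc^~ e =1 inc^~ f} -> e = f} ->
  ~~ (3 %| (size s).-1) -> feasible s v C C -> 0 < fars_del inc s C v.
Proof.
move=> s_uniq C_uniq C4 C_ext ndvd3 /andP[]; case: posnP => // -> sum_le nonadjs_le.
case/negP: ndvd3; have [-> //|s_gt0] := posnP (size s).
by apply: (nonadjs0_deficit0_dvdn s_uniq C_uniq C4 C_ext s_gt0); lia.
Qed.

End Feasibility.

Lemma feasible_relabel (V V' E E' : eqType) (inc : V -> E -> bool)
    (inc' : V' -> E' -> bool) (h : V' -> V) (g : E -> E') (s : seq V') v (C U : seq E) :
  {in s &, injective h} -> (forall x e, x \in s -> inc' x (g e) = inc (h x) e) ->
  v \in s ->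
  feasible inc' s v (map g C) (map g U) = feasible inc (map h s) (h v) C U.
Proof.
move=> h_inj inc_g vs.
have h_inj_v : {in others s v &, injective h}.
  by move=> x y /others_sub xs /others_sub; apply: h_inj.
have inc_g_v x e : x \in others s v -> inc' x (g e) = inc (h x) e.
  by move/others_sub; apply: inc_g.
rewrite /feasible /nonadjs_del /fars_del !(edges_avoiding_relabel inc_g) //.
rewrite !others_map //.
rewrite !(nonadjs_relabel h_inj inc_g) !(nonadjs_relabel h_inj_v inc_g_v).
by rewrite !(fars_relabel h_inj_v inc_g_v) (deficit_relabel h_inj inc_g) size_map.
Qed.

Section Deletion.
Variables (T : finType) (H : hypergraph T).

Lemma horder_hdel v : v \in hverts H -> horder (hdel H v) = (horder H).-1.
Proof. by move=> vV; rewrite /horder [#|hverts H|](cardsD1 v) vV. Qed.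

Lemma uniform_hdel k v : uniform H k -> uniform (hdel H v) k.
Proof. by move=> unif e; rewrite inE => /andP[/unif]. Qed.

Lemma enum_hverts_hdel v : vertices (hdel H v) = others (vertices H) v.
Proof.
rewrite /others {2}/enum_mem -filter_predI; apply: eq_filter => x.
by rewrite /= !inE.
Qed.

Lemma enum_hedges_hdel v : edges (hdel H v) = edges_avoiding (inset T) v (edges H).
Proof.
rewrite /edges_avoiding {2}/enum_mem -filter_predI; apply: eq_filter => e.
by rewrite /= !inE andbC.
Qed.

Lemma soltes_hdel_connected v : soltes H -> v \in hverts H -> hconnected (hdel H v).
Proof.
case=> con eqW vV; have [w wE _] := wiener_pairsum con.
by apply: (@wiener_connected _ _ w); rewrite eqW.
Qed.

Lemma count_inset k : uniform H k ->
  {in edges H, forall e, count ((inset T)^~ e) (vertices H) = k}.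
Proof.
move=> unif e; rewrite mem_enum => eH; rewrite -(unif e eH) cardE -size_filter.
apply/perm_size/uniq_perm => [||x]; [exact/filter_uniq/enum_uniq|exact: enum_uniq|].
rewrite mem_filter !mem_enum /inset andb_idr //.
exact/subsetP/edge_sub.
Qed.

Lemma inset_ext : {in edges H &, forall e f,
  {in vertices H, (inset T)^~ e =1 (inset T)^~ f} -> e = f}.
Proof.
move=> e f; rewrite !mem_enum => /edge_sub/subsetP eV /edge_sub/subsetP fV ef.
apply/setP => x; have [xV|xV] := boolP (x \in hverts H).
  by apply: ef; rewrite mem_enum.
by rewrite (contraNF (eV x) xV) (contraNF (fV x) xV).
Qed.

Lemma soltes_exists_feasible : 3 < horder H <= 9 -> uniform H 4 -> soltes H ->
  exists2 v, v \in vertices H & feasible (inset T) (vertices H) v (edges H) (edges H).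
Proof.
case/andP=> order_gt3 order_le9 unif sol; have [con eqW] := sol.
have [w wE _] := wiener_pairsum con; have nonadjs_w := wiener_geq wE.
have size_vertices : size (vertices H) = horder H by rewrite -cardE.
apply: (@exists_feasible _ _ _ _ _ (2 * w - horder H * (horder H).-1)) => [||||v].
- exact: enum_uniq.
- exact: count_inset.
- by rewrite size_vertices.
- by lia.
rewrite mem_enum => vV; have order_del := horder_hdel vV.
have order_del8 : horder (hdel H v) <= 4.*2 by rewrite order_del; lia.
have w_del : wiener (hdel H v) = Some w by rewrite eqW.
have := wiener_diameter3 w_del (hwalk3 order_del8 (uniform_hdel unif)
  (soltes_hdel_connected sol vV)).
rewrite enum_hverts_hdel enum_hedges_hdel order_del size_vertices.
rewrite -/(nonadjs_del _ _ _ _) -/(fars_del _ _ _ _) => w_del_eq.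
have := mulnBr (horder H).-1 (horder H) 2.
by lia.
Qed.

Lemma feasible_exists_far v : uniform H 4 -> ~~ (3 %| (horder H).-1) ->
  feasible (inset T) (vertices H) v (edges H) (edges H) ->
  exists x y, [/\ x \in hverts (hdel H v), y \in hverts (hdel H v), x != y &
    far (inset T) (vertices (hdel H v)) (edges (hdel H v)) x y].
Proof.
rewrite /horder cardE => unif ndvd3 feas.
have := feasible_fars_del_gt0 (enum_uniq _) (enum_uniq _) (count_inset unif) inset_ext
  ndvd3 feas.
rewrite lt0n pairsum_eq0 => /allPn[x xv /allPn[y]]; rewrite mem_others eqb0 negbK.
rewrite -enum_hverts_hdel -enum_hedges_hdel !mem_enum in xv * => /andP[yx yv] xy.
by exists x, y; rewrite eq_sym.
Qed.

End Deletion.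

(** * Branch and bound *)

Section BranchAndBound.
Variables (E : eqType) (feas : seq E -> seq E -> bool).
Hypothesis feasS : forall C X U : seq E,
  {subset C <= X} -> {subset X <= U} -> feas X X -> feas C U.

Fixpoint refute (rest C : seq E) : bool :=
  if feas C (C ++ rest) then
    if rest is e :: rest' then
      if refute rest' C then refute rest' (e :: C) else false
    else false
  else true.

Lemma refute_sound X rest C : {subset C <= X} -> {subset X <= C ++ rest} ->
  refute rest C -> ~~ feas X X.
Proof.
elim: rest C => [|e rest IHrest] C CX XU /=.
  by case: ifP => // /negbT nfeas _; apply: contra nfeas; apply: feasS.
case: ifP => [_|/negbT nfeas _]; last by apply: contra nfeas; apply: feasS.
case: ifP => // refute_wo refute_w; have [eX|eX] := boolP (e \in X).
  apply: (IHrest (e :: C)) => // f; first by rewrite inE => /predU1P[->|/CX].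
  by move/XU; rewrite !(mem_cat, inE) => /or3P[] ->; rewrite ?orbT.
apply: (IHrest C) => // f fX; have := XU f fX; rewrite !(mem_cat, inE).
by case/or3P=> [->|/eqP ef|->] //; rewrite ?orbT // -ef fX in eX *.
Qed.

End BranchAndBound.

(* A set of vertices 0, ..., 8 is encoded by its membership mask. *)
Definition bit (i : nat) (m : bitseq) : bool := nth false m i.

Fixpoint masks (n : nat) : seq bitseq :=
  if n is n'.+1 then [seq b :: m | b <- [:: true; false], m <- masks n']
  else [:: [::]].

Lemma mem_masks m : m \in masks (size m).
Proof.
elim: m => // b m IHm; have bb : b \in [:: true; false] by case: b.
exact: (allpairs_f cons bb IHm).
Qed.

Definition quads : seq bitseq := [seq m <- masks 9 | count id m == 4].

Definition crossing (m : bitseq) : bool := ~~ [|| bit 0 m, bit 4 m | bit 8 m].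

Definition edge0123 : bitseq := nseq 4 true ++ nseq 5 false.

Definition edge4567 : bitseq := nseq 4 false ++ nseq 4 true ++ [:: false].

(* Apart from [edge0123] and [edge4567], no edge avoiding 8 contains 0 or 4. *)
Definition candidates : seq bitseq :=
  [seq m <- quads | crossing m] ++ [seq m <- quads | bit 8 m].

Definition mask_feasible (C U : seq bitseq) : bool :=
  if has crossing U then feasible bit (iota 0 9) 8 C U else false.

Lemma mask_feasibleS C X U : {subset C <= X} -> {subset X <= U} ->
  mask_feasible X X -> mask_feasible C U.
Proof.
move=> CX XU /andP[/hasP[m mX m_crossing] feasX]; apply/andP; split.
  by apply/hasP; exists m; rewrite ?XU.
exact: feasibleS feasX.
Qed.

Lemma refutation : refute mask_feasible candidates [:: edge0123; edge4567].
Proof. vm_cast_no_check (erefl true). Qed.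

(** * Labelling the vertices by 0, ..., 8 *)

Section MaskEdges.
Variables (T : finType) (H : hypergraph T) (x0 : T) (s : seq T).
Hypotheses (order9 : horder H = 9) (s_verts : perm_eq s (vertices H)).

Definition mask_of (e : {set T}) : bitseq := [seq z \in e | z <- s].

Definition mask_edges : seq bitseq := [seq mask_of e | e <- edges H].

Lemma size_labelling : size s = 9.
Proof. by rewrite (perm_size s_verts) -cardE. Qed.

Lemma bit_mask_of i e : i < 9 -> bit i (mask_of e) = (nth x0 s i \in e).
Proof. by move=> i9; rewrite /bit (nth_map x0) ?size_labelling. Qed.

Lemma mem_mask_edges e : e \in hedges H -> mask_of e \in mask_edges.
Proof. by move=> eH; apply/map_f; rewrite mem_enum. Qed.

Lemma mask_edges_feasible i : i < 9 ->
  feasible bit (iota 0 9) i mask_edges mask_edges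
  = feasible (inset T) (vertices H) (nth x0 s i) (edges H) (edges H).
Proof.
move=> i9; rewrite (feasible_relabel (inc := inset T) (h := nth x0 s)).
- rewrite map_nth_iota0 ?size_labelling // take_oversize ?size_labelling //.
  exact: perm_feasible.
- move=> a b; rewrite !mem_iota => a9 b9 /eqP.
  by rewrite nth_uniq ?size_labelling ?(perm_uniq s_verts) ?enum_uniq // => /eqP.
- by move=> a e; rewrite mem_iota; apply: bit_mask_of.
- by rewrite mem_iota.
Qed.

Lemma mask_of_quads e : uniform H 4 -> e \in hedges H -> mask_of e \in quads.
Proof.
move=> unif eH; rewrite mem_filter -size_labelling -(size_map (mem e)) mem_masks andbT.
by rewrite count_map (permP s_verts) (count_inset unif) // mem_enum.
Qed.

End MaskEdges.

Lemma map_in_nseq (T U : eqType) (f : T -> U) (s : seq T) c :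
  {in s, forall z, f z = c} -> map f s = nseq (size s) c.
Proof.
move=> fc; rewrite -(size_map f); apply/all_pred1P; rewrite all_map.
by apply/allP => z /fc /= ->.
Qed.

Definition enum_from (T : finType) (z : T) (A : {set T}) : seq T := z :: rem z (enum A).

Lemma perm_enum_from (T : finType) (z : T) (A : {set T}) :
  z \in A -> perm_eq (enum_from z A) (enum A).
Proof. by move=> zA; rewrite perm_sym perm_to_rem // mem_enum. Qed.

Section AntipodalLabelling.
Variables (T : finType) (H : hypergraph T) (v x y : T) (A B : {set T}).
Hypotheses (order9 : horder H = 9) (uniform4 : uniform H 4) (vV : v \in hverts H).
Hypothesis anti : antipodal (hdel H v) x y A B.

Definition antipodal_labelling : seq T := enum_from x A ++ enum_from y B ++ [:: v].

Local Notation labels := antipodal_labelling.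

Lemma antipodal_hdel_edges :
  [/\ A \in hedges H, B \in hedges H, v \notin A & v \notin B].
Proof. by have [+ +] := antipodal_edges anti; rewrite !inE => /andP[] ? ? /andP[]. Qed.

Lemma perm_antipodal_blocks :
  perm_eq (enum_from x A) (enum A) /\ perm_eq (enum_from y B) (enum B).
Proof. by have [xA yB] := antipodal_mem anti; rewrite !perm_enum_from. Qed.

Lemma size_antipodal_blocks : size (enum_from x A) = 4 /\ size (enum_from y B) = 4.
Proof.
have [AH BH _ _] := antipodal_hdel_edges; have [pA pB] := perm_antipodal_blocks.
by rewrite (perm_size pA) (perm_size pB) -!cardE (uniform4 AH) (uniform4 BH).
Qed.

Lemma perm_antipodal_labelling : perm_eq labels (vertices H).
Proof.
have [_ _ vA vB] := antipodal_hdel_edges; have [pA pB] := perm_antipodal_blocks.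
apply: perm_trans (perm_cat pA (perm_cat pB (perm_refl _))) _.
apply: uniq_perm (enum_uniq _) _ => [|z].
  rewrite !cat_uniq !enum_uniq has_cat /= !mem_enum (negPf vA) (negPf vB).
  rewrite !orbF /= !andbT; apply/hasPn => z; rewrite /= !mem_enum.
  by move/(disjointFl (antipodal_disjoint anti)) => ->.
rewrite !mem_cat !mem_enum orbA -in_setU (antipodal_cover anti) !inE.
by case: eqVneq => [->|_]; rewrite ?vV ?orbF.
Qed.

Lemma nth_antipodal_labelling :
  [/\ nth v labels 0 = x, nth v labels 4 = y & nth v labels 8 = v].
Proof.
have [size_A size_B] := size_antipodal_blocks.
by rewrite /labels !nth_cat size_A size_B.
Qed.

Lemma mask_of_antipodal : mask_of labels A = edge0123 /\ mask_of labels B = edge4567.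
Proof.
have [_ _ vA vB] := antipodal_hdel_edges; have [pA pB] := perm_antipodal_blocks.
have [size_A size_B] := size_antipodal_blocks; have dAB := antipodal_disjoint anti.
rewrite /mask_of !map_cat.
have mem_xA z : z \in enum_from x A -> z \in A by rewrite (perm_mem pA) mem_enum.
have mem_yB z : z \in enum_from y B -> z \in B by rewrite (perm_mem pB) mem_enum.
rewrite (@map_in_nseq _ _ (fun z => z \in A) (enum_from x A) true) //.
rewrite (@map_in_nseq _ _ (fun z => z \in A) (enum_from y B) false); last first.
  by move=> z /mem_yB/(disjointFl dAB).
rewrite (@map_in_nseq _ _ (fun z => z \in B) (enum_from x A) false); last first.
  by move=> z /mem_xA/(disjointFr dAB).
rewrite (@map_in_nseq _ _ (fun z => z \in B) (enum_from y B) true) //.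
by rewrite size_A size_B /= (negPf vA) (negPf vB).
Qed.

Lemma sub_antipodal_mask_edges :
  {subset [:: edge0123; edge4567] <= mask_edges H labels}.
Proof.
have [AH BH _ _] := antipodal_hdel_edges; have [<- <-] := mask_of_antipodal.
by move=> m; rewrite mem_seq2 => /orP[] /eqP ->; apply: mem_mask_edges.
Qed.

Lemma antipodal_mask_edges_sub :
  {subset mask_edges H labels <= [:: edge0123; edge4567] ++ candidates}.
Proof.
have [lab0 lab4 lab8] := nth_antipodal_labelling.
have [maskA maskB] := mask_of_antipodal.
have bitE := bit_mask_of v order9 perm_antipodal_labelling.
move=> _ /mapP[e + ->]; rewrite mem_enum => eH.
have quad_e := mask_of_quads order9 perm_antipodal_labelling uniform4 eH.
rewrite /candidates !mem_cat mem_seq2 2!(mem_filter _ _ quads) quad_e !andbT.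
rewrite /crossing !bitE // lab0 lab4 lab8.
have [ve|ve] := boolP (v \in e); first by rewrite !orbT.
have e_del : e \in hedges (hdel H v) by rewrite inE eH.
have [xe|xe] := boolP (x \in e).
  by rewrite (antipodal_uniqueA anti e_del xe) maskA eqxx.
have [ye|//] := boolP (y \in e); last by rewrite !orbT.
by rewrite (antipodal_uniqueB anti e_del ye) maskB eqxx orbT.
Qed.

Lemma has_crossing_mask_edges : has crossing (mask_edges H labels).
Proof.
have [lab0 lab4 lab8] := nth_antipodal_labelling.
have [e + /andP[xe ye]] := antipodal_crossing anti; rewrite inE => /andP[eH ve].
apply/hasP; exists (mask_of labels e); first exact: mem_mask_edges.
rewrite /crossing !(bit_mask_of v order9 perm_antipodal_labelling) // lab0 lab4 lab8.
by rewrite (negPf xe) (negPf ye).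
Qed.

End AntipodalLabelling.

Theorem mainTheorem7 (T : finType) (H : hypergraph T)
  (order9 : horder H = 9) (uniform4 : uniform H 4) : ~ soltes H.
Proof.
move=> sol.
have [|v] := soltes_exists_feasible _ uniform4 sol; first by rewrite order9.
rewrite mem_enum => vV feas.
have ndvd3 : ~~ (3 %| (horder H).-1) by rewrite order9.
have [x [y [xV yV xy far_xy]]] := feasible_exists_far uniform4 ndvd3 feas.
have order_del : horder (hdel H v) <= 4.*2 by rewrite horder_hdel // order9.
have [A [B anti]] := far_antipodal order_del (uniform_hdel uniform4)
  (soltes_hdel_connected sol vV) xV yV xy far_xy.
have [_ _ lab8] := nth_antipodal_labelling uniform4 anti.
have /negP[] := refute_sound mask_feasibleS (sub_antipodal_mask_edges uniform4 anti)
  (antipodal_mask_edges_sub order9 uniform4 vV anti) refutation.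
rewrite /mask_feasible (has_crossing_mask_edges order9 uniform4 vV anti).
by rewrite (mask_edges_feasible v order9 (perm_antipodal_labelling vV anti)) ?lab8.
Qed.
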